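(* Every integral domain $D$ that contains a nonzero nonunit comparable element is a $t$-local domain. On the other hand, a $t$-local domain need not contain a nonzero nonunit comparable element; that is, there exists a $t$-local domain containing no nonzero nonunit comparable element.
   Context: A nonzero element $c$ of an integral domain $D$ is comparable in $D$ if for every $x\in D$ one has $cD\subseteq xD$ or $xD\subseteq cD$. Let $K$ be the quotient field of $D$. For a nonzero fractional ideal $E$ of $D$ put $E^{-1}=\{x\in K: xE\subseteq D\}$, $E^v=(E^{-1})^{-1}$, and $E^t=\bigcup\{F^v : F\subseteq E,\ F \text{ a nonzero finitely generated ideal}\}$. A nonzero fractional ideal $E$ is a $t$-ideal if $E=E^t$. ''Local'' means having exactly one maximal ideal (not necessarily Noetherian). An integral domain is $t$-local if it is local and its maximal ideal is a (nonzero) $t$-ideal. *)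

(* Defs.v *)
From HB Require Import structures.
From mathcomp Require Import all_boot all_order all_algebra.
From mathcomp Require Import all_classical.

Set Implicit Arguments.
Unset Strict Implicit.
Unset Printing Implicit Defensive.
Import GRing.Theory.
Local Open Scope classical_set_scope.
Local Open Scope ring_scope.

(* The quotient field of D is {fraction D}, into which D embeds by tofrac. *)
Section IntegralDomain.
Variable D : idomainType.
Implicit Types (c x y : D) (I J M : set D) (E F : set {fraction D}).

Definition principal c : set D := [set c * x | x in setT].

Definition comparable_elt c :=
  c != 0 /\
  forall x, principal c `<=` principal x \/ principal x `<=` principal c.

(* [idealr_closed] only holds of proper ideals: it includes 1 \notin I. *)
Definition maximal_ideal M :=
  idealr_closed [in M] /\
  forall J, idealr_closed [in J] -> M `<=` J -> J = M.

Definition submodule E :=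
  [/\ E 0,
      forall u v, E u -> E v -> E (u + v)
    & forall x u, E u -> E (tofrac x * u)].

Definition nonzero E := exists2 u, E u & u != 0.

Definition fractional_ideal E :=
  submodule E /\
  exists2 d : D, d != 0 & forall u, E u -> range (@tofrac D) (tofrac d * u).

(* A finitely generated submodule of the quotient field is automatically a
   fractional ideal. *)
Definition finitely_generated E :=
  exists s : seq {fraction D},
    E = [set u | exists a : 'I_(size s) -> D,
                   u = \sum_(i < size s) tofrac (a i) * s`_i].

Definition inv_ideal E : set {fraction D} :=
  [set u | forall v, E v -> range (@tofrac D) (u * v)].

Definition v_closure E := inv_ideal (inv_ideal E).

(* As E is fractional, so are the finitely generated F contained in it. When E
   is contained in D, they are exactly the finitely generated ideals of D
   contained in E. *)
Definition t_closure E : set {fraction D} :=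
  [set u | exists F,
      [/\ F `<=` E, nonzero F, finitely_generated F & v_closure F u]].

Definition t_ideal E :=
  [/\ fractional_ideal E, nonzero E & E = t_closure E].

End IntegralDomain.

Definition t_local (D : idomainType) :=
  exists M : set D,
    [/\ maximal_ideal M,
        forall N : set D, maximal_ideal N -> N = M
      & t_ideal (@tofrac D @` M)].

(* Main.v *)
Require Import Defs.
From HB Require Import structures.
From mathcomp Require Import all_boot all_order all_algebra.
From mathcomp Require Import all_classical.

Set Implicit Arguments.
Unset Strict Implicit.
Unset Printing Implicit Defensive.
Import GRing.Theory.
Local Open Scope ring_scope.

(** Both halves rest on one sufficient condition for t-locality, phrased inside
    D.  Suppose that every finite set S of nonunits lies in a proper conductor
    (bD : a), that is, b divides a x for all x in S while b does not divide a.
    - Nonunits are closed under addition: if x and y lie in (bD : a), so does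
      x + y, which therefore cannot be a unit.  So the set M of nonunits is the
      only maximal ideal.
    - M is a t-ideal: if F is generated by nonunits lying in (bD : a), then 1 and
      a/b are both in F^-1, so every v in F^v lies in D with v (a/b) in D, and a
      unit v would force b to divide a.
    The condition is [t_local_of_proper_conductors].

    Let c be a comparable nonunit.  If c = x a = y b, then comparing c with x b
    and cancelling shows that x divides y or y divides x: the divisors of c form
    a chain.  Any element either is divisible by c or divides it, so a finite set
    of nonunits has a common nonunit divisor d: the least, for divisibility, of
    c and those divisors of c that occur in the set.  The pair a = 1, b = d
    satisfies the condition.

    For the counterexample, suppose that a and b do not divide each other and
    that b divides a x for every nonunit x, so that s = a/b satisfies s M <= D.
    The same pair then serves for all finite sets, so D is t-local.  A nonunit
    c <> 0 is not comparable, since c and s c = y in D are related by the ratio s,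
    and neither s nor 1/s is in D.  The local ring at the cusp,
    k[X^2, X^3] localized at (X^2, X^3), is such a ring, with s = X^3 / X^2:
    its maximal ideal consists of the fractions without terms of degree 0 and 1,
    and is stable under multiplication by X. *)

(** * Divisibility and comparable elements *)

Lemma principalP (D : idomainType) (b a : D) :
  principal b a <-> exists z, a = b * z.
Proof.
by split=> [[z _ <-]|[z ->]]; exists z.
Qed.

Lemma principalD (D : idomainType) (b x y : D) :
  principal b x -> principal b y -> principal b (x + y).
Proof.
by move=> /principalP[u ->] /principalP[v ->]; apply/principalP;
  exists (u + v); rewrite mulrDr.
Qed.

Lemma principalMr (D : idomainType) (b x y : D) :
  principal b x -> principal b (x * y).
Proof.
by move=> /principalP[u ->]; apply/principalP; exists (u * y); rewrite mulrA.
Qed.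

Lemma principal_unitMr (D : idomainType) (b a e : D) :
  e \is a GRing.unit -> principal b (a * e) -> principal b a.
Proof. by move=> Ue /(principalMr e^-1); rewrite mulrK. Qed.

Lemma comparable_eltP (D : idomainType) (c : D) :
  comparable_elt c <->
  c != 0 /\ forall x, principal x c \/ principal c x.
Proof.
split=> -[c0 cmp]; split=> // x; case: (cmp x) => h.
- by left; apply: h; apply/principalP; exists 1; rewrite mulr1.
- by right; apply: h; apply/principalP; exists 1; rewrite mulr1.
- by left=> _ [z _ <-]; apply: principalMr.
- by right=> _ [z _ <-]; apply: principalMr.
Qed.

(** * A criterion for t-locality *)

Lemma v_closure_ext (D : idomainType) (F : set {fraction D}) (u : {fraction D}) :
  F u -> v_closure F u.
Proof. by move=> Fu w Hw; rewrite mulrC; apply: Hw. Qed.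

Definition gen_submodule (D : idomainType) (s : seq {fraction D}) : set {fraction D} :=
  [set u | exists a : 'I_(size s) -> D,
     u = \sum_(i < size s) tofrac (a i) * s`_i]%classic.

Lemma mem_gen_submodule (D : idomainType) (s : seq {fraction D}) (i : 'I_(size s)) :
  gen_submodule s s`_i.
Proof.
exists (fun j => (j == i)%:R); rewrite (bigD1 i) //= eqxx tofrac1 mul1r.
by rewrite big1 ?addr0 // => j /negPf ->; rewrite tofrac0 mul0r.
Qed.

Lemma inv_ideal_gen_submodule (D : idomainType) (s : seq {fraction D}) (u : {fraction D}) :
  (forall i : 'I_(size s), range (@tofrac D) (u * s`_i)) ->
  inv_ideal (gen_submodule s) u.
Proof.
move=> Hu _ [a ->]; rewrite mulr_sumr; apply: (big_ind (range (@tofrac D))).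
- by exists 0; rewrite ?tofrac0.
- by move=> _ _ [x _ <-] [y _ <-]; exists (x + y); rewrite ?tofracD.
- move=> i _; have [x _ Ex] := Hu i.
  by exists (a i * x) => //; rewrite mulrCA -Ex tofracM.
Qed.

(** The condition says that a/b, an element outside D, multiplies the ideal
    generated by s into D: the inverse of a finitely generated ideal of nonunits
    is strictly larger than D.  It forces both locality and the t-property. *)
Lemma t_local_of_proper_conductors (D : idomainType) (m0 : D) :
  m0 != 0 -> m0 \isn't a GRing.unit ->
  (forall s : seq D, {in s, forall x, x \isn't a GRing.unit} ->
     exists a b : D,
       [/\ b != 0, ~ principal b a & {in s, forall x, principal b (a * x)}]) ->
  t_local D.
Proof.
move=> m0n0 m0nU H.
pose M : set D := [set x | x \isn't a GRing.unit]%classic.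
have addM x y : M x -> M y -> M (x + y).
  move=> Mx My; apply/negP => Uxy.
  (* A unit x + y in the proper ideal (bD : a) is impossible. *)
  have [|a [b [_ nba ba]]] := H [:: x; y].
    by move=> z; rewrite !inE => /orP[] /eqP ->.
  apply: nba; apply: principal_unitMr Uxy _; rewrite mulrDr.
  by apply: principalD; apply: ba; rewrite !inE eqxx ?orbT.
have mulM x y : M y -> M (x * y).
  by rewrite /M /= unitrM negb_and => ->; rewrite orbT.
have idM : idealr_closed [in M].
  split.
  - by apply: mem_set; rewrite /M /= unitr0.
  - by apply/negP => /set_mem /=; rewrite /M /= unitr1.
  move=> a u v /set_mem Mu /set_mem Mv; apply: mem_set; exact: addM (mulM _ _ Mu) Mv.
have subM J : idealr_closed [in J] -> (J `<=` M)%classic.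
  move=> [J0 J1 Jlin] x Jx; apply/negP => Ux; case/negP: J1.
  rewrite -[1](addr0) -(mulVr Ux); apply: Jlin => //; exact: mem_set.
have maxM : maximal_ideal M.
  by split=> // J idJ MJ; apply/seteqP; split=> //; apply: subM.
exists M; split=> // [N [idN maxN]|].
  by rewrite (maxN M idM) //; apply: subM.
have fracM : fractional_ideal (@tofrac D @` M)%classic.
  split; last first.
    by exists 1; rewrite ?oner_neq0 // => _ [x _ <-]; rewrite tofrac1 mul1r; exists x.
  split.
  - by exists 0; rewrite ?tofrac0 // /M /= unitr0.
  - by move=> _ _ [x Mx <-] [y My <-]; exists (x + y); rewrite ?tofracD //; apply: addM.
  - by move=> x _ [y My <-]; exists (x * y); rewrite ?tofracM //; apply: mulM.
split=> //; first by exists (tofrac m0); rewrite ?tofrac_eq0 //; exists m0.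
apply/seteqP; split=> [_ [m Mm <-]|u [F [FM _ [s defF] Fu]]].
(* The generator m0 keeps F nonzero when m = 0. *)
- exists (gen_submodule [:: tofrac m; tofrac m0]); split.
  + have [[M0 MD MZ] _] := fracM.
    move=> _ [a ->]; apply: (big_ind (@tofrac D @` M)%classic) => // i _.
    by apply: MZ; case: i => -[|[|]] //= ?; [exists m|exists m0].
  + exists (tofrac m0); rewrite ?tofrac_eq0 //.
    exact: (@mem_gen_submodule _ [:: _; _] (Ordinal (isT : 1 < 2)%N)).
  + by eexists.
  + apply: v_closure_ext; exact: (@mem_gen_submodule _ [:: _; _] (Ordinal (isT : 0 < 2)%N)).
- have Ms (i : 'I_(size s)) : exists2 x, M x & tofrac x = s`_i.
    have /FM[x Mx Ex] : F s`_i by rewrite defF; apply: mem_gen_submodule.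
    by exists x.
  pose x i := projT1 (cid2 (Ms i)).
  have Mx i : M (x i) by rewrite /x; case: cid2.
  have Ex i : tofrac (x i) = s`_i by rewrite /x; case: cid2.
  have [|a [b [b0 nba ba]]] := H [seq x i | i <- enum 'I_(size s)].
    by move=> _ /mapP[i _ ->]; apply: Mx.
  have Dinv w : (forall i, range (@tofrac D) (w * tofrac (x i))) ->
      range (@tofrac D) (u * w).
    move=> Hw; apply: Fu; rewrite defF; apply: inv_ideal_gen_submodule => i.
    by rewrite -Ex; apply: Hw.
  (* The inverse of F contains 1, hence u is in D; it also contains a / b. *)
  have [y _ Ey] : range (@tofrac D) (u * 1).
    by apply: Dinv => i; rewrite mul1r; exists (x i).
  have [z _ Ez] : range (@tofrac D) (u * (tofrac a / tofrac b)).
    apply: Dinv => i.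
    have /principalP[t Et] : principal b (a * x i).
      by apply: ba; apply: map_f; rewrite mem_enum.
    exists t => //; rewrite mulrAC -tofracM Et tofracM mulrAC mulfV ?mul1r //.
    by rewrite tofrac_eq0.
  rewrite mulr1 in Ey; rewrite -Ey; exists y => //; apply/negP => Uy; apply: nba.
  apply: principal_unitMr Uy _; apply/principalP; exists z; apply/eqP.
  rewrite -tofrac_eq !tofracM Ez Ey; apply/eqP.
  by rewrite (mulrC u) mulrA [X in _ = X * _]mulrC divfK // tofrac_eq0.
Qed.

(** * Domains with a comparable element *)

(** With c = x a = y b, comparability of c and x b is, after cancelling b,
    comparability of y and x. *)
Lemma comparable_elt_divisors (D : idomainType) (c x y : D) :
  comparable_elt c -> principal x c -> principal y c ->
  principal x y \/ principal y x.
Proof.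
move=> /comparable_eltP[c0 cmp] /principalP[a Ea] /principalP[b Eb].
have x0 : x != 0 by apply: contraNneq c0 => x0; rewrite Ea x0 mul0r.
have b0 : b != 0 by apply: contraNneq c0 => b0; rewrite Eb b0 mulr0.
case: (cmp (x * b)) => /principalP[z Ez]; [left|right]; apply/principalP;
  exists z; apply: (mulIf b0).
- by rewrite -Eb Ez mulrAC.
- by rewrite Ez Eb mulrAC.
Qed.

(** Requiring that d divide c is what makes the induction work: the next element
    is either a multiple of c, hence of d, or a divisor of c, hence in a chain
    with d. *)
Lemma comparable_elt_common_divisor (D : idomainType) (c : D) (s : seq D) :
  comparable_elt c -> c \isn't a GRing.unit ->
  {in s, forall x, x \isn't a GRing.unit} ->
  exists d, [/\ d \isn't a GRing.unit, principal d c
              & {in s, forall x, principal d x}].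
Proof.
move=> cmp cnU; elim: s => [|x s IHs] nU.
  by exists c; split=> //; apply/principalP; exists 1; rewrite mulr1.
have [|d [dnU dc ds]] := IHs.
  by move=> y ys; apply: nU; rewrite inE ys orbT.
have xnU : x \isn't a GRing.unit by apply: nU; rewrite inE eqxx.
have trans (u v w : D) : principal u v -> principal v w -> principal u w.
  by move=> uv /principalP[z ->]; apply: principalMr.
have [xc|cx] := ((comparable_eltP c).1 cmp).2 x; last first.
  by exists d; split=> // y /predU1P[->|/ds //]; apply: trans cx.
have [xd|dx] := comparable_elt_divisors cmp xc dc.
- exists x; split=> // y /predU1P[->|/ds]; last exact: trans.
  by apply/principalP; exists 1; rewrite mulr1.
- by exists d; split=> // y /predU1P[->|/ds //].
Qed.

Lemma t_local_of_comparable_elt (D : idomainType) (c : D) :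
  comparable_elt c -> c \isn't a GRing.unit -> t_local D.
Proof.
move=> cmp cnU; have c0 := cmp.1.
apply: (t_local_of_proper_conductors c0 cnU) => s nU.
have [d [dnU dc ds]] := comparable_elt_common_divisor cmp cnU nU.
exists 1, d; split=> [||x /ds]; last by rewrite mul1r.
- by move/principalP: dc c0 => [z ->]; rewrite mulf_eq0 => /norP[].
- move=> /principalP[z Ez]; case/negP: dnU; apply/unitrP; exists z.
  by rewrite mulrC -Ez.
Qed.

(** * A t-local domain without comparable nonunits *)

(** The fraction a/b multiplies the maximal ideal into D, so one pair (a, b)
    serves for every finite set of nonunits.  For a nonunit c != 0, the product
    y = c (a/b) is in D, and a comparison of c with y would put a/b or b/a in D. *)
Lemma t_local_without_comparable_elt (D : idomainType) (a b : D) :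
  b != 0 -> ~ principal a b -> ~ principal b a ->
  b \isn't a GRing.unit ->
  (forall x, x \isn't a GRing.unit -> principal b (a * x)) ->
  t_local D /\
  ~ (exists c : D, [/\ c != 0, c \isn't a GRing.unit & comparable_elt c]).
Proof.
move=> b0 nab nba bnU Hx; split.
  apply: (t_local_of_proper_conductors b0 bnU) => s nU.
  by exists a, b; split=> // x /nU; apply: Hx.
move=> [c [c0 cnU /comparable_eltP[_ cmp]]].
have /principalP[y Ey] := Hx c cnU.
have a0 : a != 0.
  by apply/eqP => a0; apply: nba; apply/principalP; exists 0; rewrite a0 mulr0.
case: (cmp y) => /principalP[z Ez].
- apply: nab; apply/principalP; exists z.
  have y0 : y != 0 by apply: contraNneq c0 => y0; rewrite Ez y0 mul0r.
  by apply: (mulIf y0); rewrite -Ey Ez -mulrA (mulrC z).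
- apply: nba; apply/principalP; exists z.
  by apply: (mulIf c0); rewrite Ey Ez mulrA mulrAC.
Qed.

(** * The local ring at the cusp *)

(** The local ring of the curve y^2 = x^3 at its singular point: a polynomial lies
    in k[X^2, X^3] exactly when its coefficient of degree 1 vanishes, and
    inverting those with nonzero constant term amounts to inverting those with
    constant term 1. *)
Definition cusp_local_pred : {pred {fraction {poly rat}}} := fun f =>
  `[< exists p q : {poly rat},
        [/\ p`_1 = 0, q`_1 = 0, q`_0 = 1 & f = tofrac p / tofrac q] >].

Lemma coef1M (R : nzRingType) (p q : {poly R}) :
  (p * q)`_1 = p`_0 * q`_1 + p`_1 * q`_0.
Proof. by rewrite coefM !big_ord_recl big_ord0 addr0. Qed.

Lemma poly_neq0_coef0 (R : nzRingType) (q : {poly R}) : q`_0 = 1 -> q != 0.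
Proof. by move=> q0; apply/eqP => qE; move/eqP: q0; rewrite qE coef0 eq_sym oner_eq0. Qed.

Lemma cusp_local_subring : subring_closed cusp_local_pred.
Proof.
split=> [|f g /asboolP[p [q [p1 q1 q0 ->]]] /asboolP[r [s [r1 s1 s0 ->]]]
         |f g /asboolP[p [q [p1 q1 q0 ->]]] /asboolP[r [s [r1 s1 s0 ->]]]].
- by apply/asboolP; exists 1, 1; rewrite !coef1 tofrac1 divr1.
- apply/asboolP; exists (p * s - r * q), (q * s).
  rewrite coefB !coef1M p1 q1 r1 s1 coef0M q0 s0.
  split; rewrite ?(mulr0, mul0r, addr0, subr0, mulr1) //.
  by rewrite -mulNr addf_div ?tofrac_eq0 ?poly_neq0_coef0 // mulNr tofracB !tofracM.
- apply/asboolP; exists (p * r), (q * s).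
  rewrite !coef1M p1 q1 r1 s1 coef0M q0 s0.
  split; rewrite ?(mulr0, mul0r, addr0, mulr1) //.
  by rewrite !tofracM mulf_div.
Qed.

HB.instance Definition _ :=
  GRing.isSubringClosed.Build {fraction {poly rat}} cusp_local_pred cusp_local_subring.

Definition cusp_local : Type := {f | f \in cusp_local_pred}.
Definition cusp_local_of f (Df : f \in cusp_local_pred) : cusp_local :=
  exist _ f Df.
HB.instance Definition _ := SubType.on cusp_local.
HB.instance Definition _ := Choice.on cusp_local.
HB.instance Definition _ := [SubChoice_isSubComNzRing of cusp_local by <:].

(** The subring is not closed under inverses, so units are those elements that
    have an inverse in it, chosen classically. *)
Definition cusp_local_unit : {pred cusp_local} :=
  fun f => `[< exists g, g * f = 1 >].

Definition cusp_local_inv (f : cusp_local) : cusp_local :=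
  if pselect (exists g, g * f = 1) is left h then projT1 (cid h) else f.

Lemma cusp_local_mulVf : {in cusp_local_unit, left_inverse 1 cusp_local_inv *%R}.
Proof.
move=> f /asboolP Hf; rewrite /cusp_local_inv; case: pselect => // h.
by case: cid.
Qed.

Lemma cusp_local_unitP (f g : cusp_local) : g * f = 1 -> cusp_local_unit f.
Proof. by move=> gf; apply/asboolP; exists g. Qed.

Lemma cusp_local_inv_out : {in [predC cusp_local_unit], cusp_local_inv =1 id}.
Proof.
move=> f nUf; rewrite /cusp_local_inv; case: pselect => // h.
by case/negP: nUf; apply/asboolP.
Qed.

HB.instance Definition _ := GRing.ComNzRing_hasMulInverse.Build cusp_local
  cusp_local_mulVf cusp_local_unitP cusp_local_inv_out.

Lemma cusp_local_integral : GRing.integral_domain_axiom cusp_local.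
Proof.
move=> f g /(congr1 val) /eqP; rewrite rmorphM rmorph0 mulf_eq0.
by rewrite -!val_eqE rmorph0.
Qed.

HB.instance Definition _ := GRing.ComUnitRing_isIntegral.Build cusp_local
  cusp_local_integral.

Lemma mulf_div_scaled (K : fieldType) (c x y : K) :
  x != 0 -> y != 0 -> c != 0 -> x / y * (c * y / (c * x)) = 1.
Proof.
move=> x0 y0 c0.
by rewrite -mulf_div divff // mul1r mulf_div (mulrC y) divff // mulf_neq0.
Qed.

Lemma val_cusp_localM (f g : cusp_local) : val (f * g) = val f * val g.
Proof. by []. Qed.

(** A nonunit p/q has p(0) = 0, for otherwise q/p, normalized by p(0), is again in
    the ring; and X p then has no term of degree 1. *)
Lemma cusp_local_nonunitMX (f : cusp_local) :
  f \isn't a GRing.unit -> tofrac 'X * val f \in cusp_local_pred.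
Proof.
case: f => f Df /= nU; have /asboolP[p [q [p1 q1 q0 Ef]]] := Df.
have [p0|p0] := eqVneq p`_0 0.
  apply/asboolP; exists ('X * p), q; split=> //.
  - by rewrite coefXM.
  - by rewrite tofracM Ef mulrA.
(* Dividing numerator and denominator by p(0) gives q/p a denominator of constant term 1. *)
case/negP: nU.
have Dg : tofrac ((p`_0)^-1 *: q) / tofrac ((p`_0)^-1 *: p) \in cusp_local_pred.
  apply/asboolP; do 2!eexists; split; last by [].
  - by rewrite coefZ q1 mulr0.
  - by rewrite coefZ p1 mulr0.
  - by rewrite coefZ mulVf.
have pn0 : p != 0 by apply: contraNneq p0 => ->; rewrite coef0.
have qn0 := poly_neq0_coef0 q0.
apply/unitrPr; exists (cusp_local_of Dg); apply: val_inj; rewrite rmorphM rmorph1.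
change (f * (tofrac ((p`_0)^-1 *: q) / tofrac ((p`_0)^-1 *: p)) = 1 :> {fraction {poly rat}}).
rewrite Ef -!mul_polyC !tofracM.
apply: mulf_div_scaled; rewrite tofrac_eq0 //.
by rewrite polyC_eq0 invr_eq0.
Qed.

Lemma tofracX_cusp_local (n : nat) : tofrac 'X^(n.+2) \in cusp_local_pred.
Proof.
by apply/asboolP; exists 'X^(n.+2), 1; rewrite !coef1 coefXn tofrac1 divr1.
Qed.

Lemma tofracX_notin : tofrac 'X \notin cusp_local_pred.
Proof.
apply/negP => /asboolP[p [q [p1 q1 q0 E]]].
have qn0 := poly_neq0_coef0 q0.
have /eqP : 'X * q = p.
  by apply/eqP; rewrite -tofrac_eq tofracM E divfK // tofrac_eq0.
move=> /eqP/(congr1 (fun r : {poly rat} => r`_1)).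
by rewrite coefXM q0 p1 => /eqP; rewrite oner_eq0.
Qed.

Lemma tofracXV_notin (f : {fraction {poly rat}}) :
  1 = tofrac 'X * f -> f \notin cusp_local_pred.
Proof.
move=> Xf; apply/negP => /asboolP[p [q [p1 q1 q0 Ef]]].
have qn0 := poly_neq0_coef0 q0.
have : q = 'X * p.
  apply/eqP; rewrite -tofrac_eq tofracM -[tofrac q]mul1r Xf Ef -mulrA divfK //.
  by rewrite tofrac_eq0.
move=> /(congr1 (fun r : {poly rat} => r`_0)).
by rewrite coefXM q0 => /eqP; rewrite oner_eq0.
Qed.

Theorem proposition4p7 :
  (forall D : idomainType,
     (exists c : D, [/\ c != 0, c \isn't a GRing.unit & comparable_elt c]) ->
     t_local D) /\
  (exists D : idomainType,
     t_local D /\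
     ~ (exists c : D, [/\ c != 0, c \isn't a GRing.unit & comparable_elt c])).
Proof.
split=> [D [c [_ cnU cmp]]|]; first exact: t_local_of_comparable_elt cmp cnU.
(* The pair a = X^3, b = X^2, with ratio X. *)
pose a : cusp_local := cusp_local_of (tofracX_cusp_local 1).
pose b : cusp_local := cusp_local_of (tofracX_cusp_local 0).
have X0 : tofrac 'X != 0 :> {fraction {poly rat}} by rewrite tofrac_eq0 polyX_eq0.
have vb : val b = tofrac 'X ^+ 2 by rewrite /= tofracXn.
have va : val a = val b * tofrac 'X by rewrite vb /= tofracXn exprSr.
have vb0 : val b != 0 by rewrite vb expf_neq0.
have b0 : b != 0 by apply: contraNneq vb0 => ->.
have nba : ~ principal b a.
  move=> /principalP[z /(congr1 val)]; rewrite val_cusp_localM va.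
  by move=> /(mulfI vb0) E; move: (valP z); rewrite -E (negPf tofracX_notin).
exists cusp_local; apply: (t_local_without_comparable_elt b0 _ nba).
- move=> /principalP[z /(congr1 val)]; rewrite val_cusp_localM va.
  rewrite -{1}[val b]mulr1 -mulrA => /(mulfI vb0) E.
  by move: (valP z); rewrite (negPf (tofracXV_notin E)).
- apply/negP => Ub; apply: nba; apply/principalP; exists (b^-1 * a).
  by rewrite mulVKr.
- move=> f /cusp_local_nonunitMX Df; apply/principalP.
  exists (cusp_local_of Df); apply: val_inj.
  by rewrite !val_cusp_localM va mulrA.
Qed.
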